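(* Let $n\geq 3$ and let $d$ be an integer with $1\leq d\leq \left\lfloor \frac{n-1}{2}\right\rfloor$. For integers $n,t$ put $h(n,t):=\binom{n-t}{2}+t^2$. Suppose that $G$ is an $n$-vertex nonhamiltonian graph with minimum degree $\delta(G)\geq d$ such that \[ e(G) > \max\left\{ h(n,d+1),\ h\!\left(n,\left\lfloor \tfrac{n-1}{2}\right\rfloor\right)\right\}. \] Then $G$ is (isomorphic to) a subgraph of either $H_{n,d}$ or $H'_{n,d}$.
   Context: $e(G)$ denotes the number of edges of $G$. $H_{n,d}$ is the graph obtained from a complete graph $K_{n-d}$ with vertex set $A$ by adding $d$ new vertices, each of degree $d$, all adjacent to the same $d$ vertices of $A$ (and to nothing else). $H'_{n,d}$ is the $n$-vertex graph that is the edge-disjoint union of two complete graphs $K_{n-d}$ and $K_{d+1}$ sharing exactly one vertex. *)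

(* Defs.v *)
From mathcomp Require Import all_boot.

Set Implicit Arguments.
Unset Strict Implicit.
Unset Printing Implicit Defensive.

Record sgraph (T : finType) := SGraph {
  adj :> rel T;
  adj_sym : symmetric adj;
  adj_irrefl : irreflexive adj
}.

Definition edges (T : finType) (G : sgraph T) : {set {set T}} :=
  [set [set x; y] | x in T, y in T & G x y].

Definition num_edges (T : finType) (G : sgraph T) : nat := #|edges G|.

Definition degree (T : finType) (G : sgraph T) (x : T) : nat :=
  #|[set y | G x y]|.

(* Every degree is smaller than #|T|, so the default value #|T| does not
   affect the minimum as soon as T is nonempty. *)
Definition min_degree (T : finType) (G : sgraph T) : nat :=
  \big[minn/#|T|]_(x : T) degree G x.

(* The size condition excludes the degenerate closed walks on at most two
   vertices, which [ucycle] accepts. *)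
Definition hamiltonian (T : finType) (G : sgraph T) : Prop :=
  exists s : seq T, [/\ 3 <= size s, ucycle G s & forall x : T, x \in s].

(* G is isomorphic to a (not necessarily induced) subgraph of H. *)
Definition subgraph_upto_iso (T U : finType) (G : sgraph T) (H : sgraph U) :
    Prop :=
  exists2 f : T -> U, injective f & forall x y : T, G x y -> H (f x) (f y).

(* The subtraction is truncated, hence h n t is the intended value for
   t <= n. *)
Definition h (n t : nat) : nat := 'C(n - t, 2) + t ^ 2.

(* For d <= n - d: the clique A is {0, ..., n - d - 1}, the d new vertices are
   {n - d, ..., n - 1}, and their common neighbourhood is {0, ..., d - 1}. *)
Definition Hnd_adj (n d : nat) : rel 'I_n := fun x y =>
  (x != y) && [|| (x < n - d) && (y < n - d),
                  (x < d) && (n - d <= y) | (y < d) && (n - d <= x)].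

Lemma Hnd_adj_sym n d : symmetric (@Hnd_adj n d).
Proof.
by move=> x y; rewrite /Hnd_adj eq_sym [(x < n - d) && _]andbC [X in _ || X]orbC.
Qed.

Lemma Hnd_adj_irrefl n d : irreflexive (@Hnd_adj n d).
Proof. by move=> x; rewrite /Hnd_adj eqxx. Qed.

Definition Hnd (n d : nat) : sgraph 'I_n :=
  SGraph (@Hnd_adj_sym n d) (@Hnd_adj_irrefl n d).

(* For d < n: the cliques are {0, ..., n - d - 1} and {n - d - 1, ..., n - 1},
   with common vertex n - d - 1. *)
Definition Hnd'_adj (n d : nat) : rel 'I_n := fun x y =>
  (x != y) && ((x < n - d) && (y < n - d) ||
               (n - d.+1 <= x) && (n - d.+1 <= y)).

Lemma Hnd'_adj_sym n d : symmetric (@Hnd'_adj n d).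
Proof.
move=> x y; rewrite /Hnd'_adj eq_sym [(x < n - d) && _]andbC.
by rewrite [(n - d.+1 <= x) && _]andbC.
Qed.

Lemma Hnd'_adj_irrefl n d : irreflexive (@Hnd'_adj n d).
Proof. by move=> x; rewrite /Hnd'_adj eqxx. Qed.

Definition Hnd' (n d : nat) : sgraph 'I_n :=
  SGraph (@Hnd'_adj_sym n d) (@Hnd'_adj_irrefl n d).

(* Main.v *)
(* Enlarge G to a saturated graph: nonadjacent vertices then have degree sum
   at most n - 1 (Ore). Put m = (n - 1) / 2 and let k <= m be maximal such that
   at least k vertices have degree at most k. Since e(G) > h(n, m), k < m, and an
   extremal choice of a nonadjacent pair shows that the set D of these vertices
   has size k and that G - D is complete. By convexity of h(n, .), k = d.
   The vertices of S = N(D) \ D have degree at least n - d, so by Ore S is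
   completely joined to D. If |S| = d then D is independent and G is in H_{n,d};
   if |S| = 1 then G is in H'_{n,d}; and 1 < |S| < d would make G hamiltonian,
   by Dirac's theorem for D together with all but one vertex of S. *)
Require Import Defs.
From mathcomp Require Import all_boot zify.

Set Implicit Arguments.
Unset Strict Implicit.
Unset Printing Implicit Defensive.

(** * Edge-maximal nonhamiltonian graphs *)

Section Saturation.
Variable T : finType.
Implicit Types (G : sgraph T) (u v x y : T) (A D : {set T}).

(** Makes hamiltonicity decidable: a spanning cycle without repetition has exactly [#|T|] entries,
    so the search ranges over a finite type of tuples. *)
Lemma hamiltonianP G :
  reflect (hamiltonian G) ((3 <= #|T|) && [exists s : #|T|.-tuple T, ucycleb G s]).
Proof.
apply: (iffP andP) => [[T_ge3 /existsP[s s_cyc]]|[s [s_ge3 s_cyc s_all]]].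
  have [_ s_uniq] := andP s_cyc.
  exists s; split=> // [|x]; first by rewrite size_tuple.
  have eq_size : size s = size (enum T) by rewrite size_tuple -cardE.
  have sub_enum : {subset s <= enum T} by move=> z _; rewrite mem_enum.
  by have [_ ->] := uniq_min_size s_uniq sub_enum (eq_leq (esym eq_size)); rewrite mem_enum.
have [_ s_uniq] := andP s_cyc.
have s_size : size s == #|T|.
  by rewrite -(card_uniqP s_uniq); apply/eqP/eq_card => x; rewrite s_all.
split; first by rewrite -(eqP s_size).
by apply/existsP; exists (Tuple s_size).
Qed.

(** The guard [x != y] keeps the relation irreflexive even when [u = v]. *)
Definition add_edge_rel G u v : rel T := fun x y =>
  G x y || (x != y) && ((x == u) && (y == v) || (x == v) && (y == u)).

Lemma add_edge_sym G u v : symmetric (add_edge_rel G u v).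
Proof.
move=> x y; rewrite /add_edge_rel adj_sym eq_sym; congr (_ || _ && _).
by rewrite orbC [(y == u) && _]andbC [(y == v) && _]andbC.
Qed.

Lemma add_edge_irrefl G u v : irreflexive (add_edge_rel G u v).
Proof. by move=> x; rewrite /add_edge_rel eqxx adj_irrefl. Qed.

Definition add_edge G u v : sgraph T :=
  SGraph (@add_edge_sym G u v) (@add_edge_irrefl G u v).

Definition saturated G : Prop :=
  ~ hamiltonian G /\
  forall u v, u != v -> ~~ G u v -> hamiltonian (add_edge G u v).

(** Induction on the number of nonadjacent ordered pairs: as long as some new edge creates no
    hamiltonian cycle, add it. *)
Lemma saturated_supergraph G :
  ~ hamiltonian G -> exists2 G' : sgraph T, subrel G G' & saturated G'.
Proof.
have [m] := ubnP #|[set p : T * T | ~~ G p.1 p.2]|.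
elim: m G => // m IHm G lt_m nhamG.
have [|/existsPn satG] := boolP [exists u, exists v, [&& u != v, ~~ G u v &
    ~~ ((3 <= #|T|) && [exists s : #|T|.-tuple T, ucycleb (add_edge G u v) s])]].
  case/existsP=> u /existsP[v /and3P[neq_uv Guv /hamiltonianP nham]].
  have subG : subrel G (add_edge G u v) by move=> x y /= Gxy; rewrite /add_edge_rel Gxy.
  have [|G' subG' satG'] := IHm (add_edge G u v) _ nham.
    rewrite -ltnS; apply: leq_trans lt_m; rewrite ltnS; apply: proper_card; apply/properP; split.
      by apply/subsetP=> -[x y]; rewrite !inE /=; apply: contra => /subG.
    by exists (u, v); rewrite !inE //= /add_edge_rel neq_uv !eqxx orbT.
  by exists G' => // x y /subG /subG'.
exists G => //; split=> // u v neq_uv Guv; apply/hamiltonianP.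
by have /existsPn/(_ v) := satG u; rewrite neq_uv Guv /= negbK.
Qed.

(** The cycle must use the added edge, since otherwise it would lie in [G]; removing that edge
    leaves the path. *)
Lemma hamiltonian_path_of_add_edge G u v :
    ~ hamiltonian G -> u != v -> hamiltonian (add_edge G u v) ->
  exists p, [/\ path G u p, last u p = v, uniq (u :: p)
               & forall x, x \in u :: p].
Proof.
move=> nhamG neq_uv [s [s_ge3 /andP[s_cyc s_uniq] s_all]].
have [i p def_s] := rot_to (s_all u).
have p_all x : x \in u :: p by rewrite -def_s mem_rot.
have p_uniq : uniq (u :: p) by rewrite -def_s rot_uniq.
have p_size : 2 <= size p by rewrite -ltnS -[(size p).+1]/(size (u :: p)) -def_s size_rot.
have : cycle (add_edge G u v) (u :: p) by rewrite -def_s rot_cycle.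
case: p {s_ge3 s_cyc s_uniq s_all def_s i} p_all p_uniq p_size => // a p p_all p_uniq p_size.
have [uNp ap_uniq] := andP p_uniq.
have last_p : last a p \in p by case: (p) p_size => //= b q _; rewrite mem_last.
have aNp : a \notin p by have /andP[] := ap_uniq.
have lastNu : last a p != u by apply: contraNneq uNp => <-; rewrite inE last_p orbT.
have aNu : a != u by apply: contraNneq uNp => <-; rewrite inE eqxx.
rewrite /= rcons_path => /and3P[e_ua e_p e_lastu].
have G_p : path G a p.
  (* The added edge contains [u], which [p] avoids, so this stretch already lies in [G]. *)
  apply: (sub_in_path (P := predC1 u)) e_p; last first.
    by apply/allP=> x xp; apply: contraNneq uNp => <-.
  move=> x y; rewrite !inE /= /add_edge_rel => /negPf -> /negPf ->.
  by rewrite ?andbF ?orbF.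
have e_u x : add_edge G u v u x -> x = v \/ G u x.
  rewrite /= /add_edge_rel eqxx => /orP[->|]; first by right.
  by rewrite (negPf neq_uv) /= orbF => /andP[_ /eqP->]; left.
(* On the cycle read from [u], the added edge comes first or last; if it comes first, the cycle is
   read backwards. *)
case: (e_u _ e_ua) => [a_v|Gua].
  exists (rev (a :: p)).
  have [last_v|Glast] : last a p = v \/ G u (last a p) by apply: e_u; rewrite adj_sym.
    by move: aNp; rewrite a_v -last_v last_p.
  have rev_ap : rev (a :: p) = last a p :: rev (belast a p) by rewrite lastI rev_rcons.
  split.
  - rewrite rev_ap /= Glast rev_path.
    by rewrite (eq_path (e' := G)) // => x y; rewrite adj_sym.
  - by rewrite rev_cons last_rcons.
  - by rewrite /= mem_rev uNp rev_uniq.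
  - by move=> x; rewrite inE mem_rev -in_cons.
have [last_v|Glast] : last a p = v \/ G u (last a p) by apply: e_u; rewrite adj_sym.
  by exists (a :: p); rewrite /= Gua.
case: nhamG; exists (u :: a :: p); split=> //.
by rewrite /ucycle p_uniq /= Gua rcons_path G_p adj_sym Glast.
Qed.

(** * Ore's degree sum condition *)

Lemma count_path_disjoint (a b : pred T) x p :
    path (fun y z => ~~ (b y && a z)) x p ->
  count b (belast x p) + count a p <= size p.
Proof.
elim: p x => //= y p IHp x /andP[nab /IHp]; move: nab.
(* Each link of the path contributes at most one to the two counts together. *)
by case: (b x); case: (a y) => //= _; lia.
Qed.

Lemma degree_count G s x :
  uniq s -> (forall y, y \in s) -> degree G x = count (G x) s.
Proof.
move=> s_uniq s_all; rewrite /degree -size_filter -(card_uniqP (filter_uniq _ s_uniq)).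
by apply: eq_card => y; rewrite inE mem_filter s_all andbT.
Qed.

(* Ore's rotation: consecutive vertices y, z on a hamiltonian path from u to v
   with y adjacent to v and z adjacent to u yield a hamiltonian cycle. *)
Lemma saturated_degree_sum G u v :
    3 <= #|T| -> saturated G -> u != v -> ~~ G u v ->
  degree G u + degree G v < #|T|.
Proof.
move=> T_ge3 [nhamG satG] neq_uv Guv.
have [p [G_p last_p p_uniq p_all]] :=
  hamiltonian_path_of_add_edge nhamG neq_uv (satG u v neq_uv Guv).
have p_size : (size p).+1 = #|T|.
  rewrite -[LHS]/(size (u :: p)) -(card_uniqP p_uniq).
  by apply: eq_card => x; rewrite p_all.
(* No vertex is its own neighbour, so [u] drops out of its own count and [v] out of its own. What
   remains counts right ends of links adjacent to [u] and left ends adjacent to [v]. *)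
rewrite !(degree_count G _ p_uniq p_all) [in X in _ + X]lastI last_p -cats1.
rewrite count_cat /= !adj_irrefl /= !addn0 add0n -p_size ltnS addnC.
apply: count_path_disjoint; apply/(pathP u) => i lt_ip; apply/negP => /andP[Gv Gu].
case: nhamG.
have Gvlast : G v (last u (take i p)).
  rewrite (last_nth u) size_takel ?(ltnW lt_ip) //.
  by rewrite -[u :: take i p]/(take i.+1 (u :: p)) nth_take.
clear Gv.
have def_p : p = take i p ++ nth u p i :: drop i.+1 p by rewrite -drop_nth ?cat_take_drop.
move: {lt_ip} (take i p) (nth u p i) (drop i.+1 p) def_p Gvlast Gu => p1 y p2 def_p Gv Gu.
(* The cycle follows [p1] from [u], jumps to [v], runs back along the path to [y], and closes at
   [u]. *)
have cyc_p : perm_eq (u :: p1 ++ rev (y :: p2)) (u :: p).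
  by rewrite def_p perm_cons perm_cat2l perm_rev.
exists (u :: p1 ++ rev (y :: p2)); split.
- by rewrite (perm_size cyc_p) /= p_size.
- apply/andP; split; last by rewrite (perm_uniq cyc_p).
  move: G_p last_p; rewrite {1 2}def_p cat_path last_cat /= => /and3P[G_p1 _ G_p2] last_p2.
  have rev_p2 : rev (y :: p2) = v :: rev (belast y p2) by rewrite lastI rev_rcons last_p2.
  rewrite /= rcons_path cat_path last_cat G_p1 rev_cons last_rcons -rev_cons.
  rewrite rev_p2 /= adj_sym Gv -last_p2 rev_path [G y u]adj_sym Gu andbT.
  by rewrite (eq_path (e' := G)) // => x z; rewrite adj_sym.
- by move=> x; rewrite (perm_mem cyc_p).
Qed.

(** * Complete graphs and Dirac's theorem *)

Lemma clique_path G x p :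
    uniq (x :: p) -> {in x :: p &, forall y z, y != z -> G y z} -> path G x p.
Proof.
elim: p x => //= y p IHp x /andP[xNp y_uniq] cliq.
have neq_xy : x != y by apply: contraNneq xNp => ->; rewrite inE eqxx.
rewrite cliq ?inE ?eqxx ?orbT //=; apply: IHp => // a b ap bp.
by apply: cliq; rewrite inE ?ap ?bp orbT.
Qed.

(** Otherwise the graph is complete, and any enumeration of its at least three vertices is a
    hamiltonian cycle. *)
Lemma saturated_nonadjacent G :
  3 <= #|T| -> saturated G -> exists u v, u != v /\ ~~ G u v.
Proof.
move=> T_ge3 [nhamG _].
have [/existsP[u /existsP[v /andP[neq_uv Guv]]]|/existsPn cliq] :=
  boolP [exists u, exists v, (u != v) && ~~ G u v]; first by exists u, v.
have {}cliq x y : x != y -> G x y.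
  by move=> neq_xy; have /existsPn/(_ y) := cliq x; rewrite neq_xy negbK.
have := enum_uniq T; have : forall x, x \in enum T by move=> x; rewrite mem_enum.
rewrite cardE in T_ge3; case: (enum T) T_ge3 => // x p p_size p_all p_uniq.
case: nhamG; exists (x :: p); split=> //; apply/andP; split=> //.
have G_p : path G x p by apply: clique_path p_uniq _ => y z _ _; apply: cliq.
rewrite /= rcons_path G_p; apply: cliq.
have /andP[xNp _] := p_uniq; apply: contraNneq xNp => <-.
by case: (p) p_size => //= a q _; rewrite mem_last.
Qed.

Lemma degree_subrel G G' x : subrel G G' -> degree G x <= degree G' x.
Proof. by move=> subG; apply/subset_leq_card/subsetP=> y; rewrite !inE; apply: subG. Qed.

Lemma num_edges_subrel G G' : subrel G G' -> num_edges G <= num_edges G'.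
Proof.
move=> subG; apply/subset_leq_card/subsetP=> e /imset2P[x y xT].
by rewrite inE => /andP[_ /subG Gxy] ->; apply: imset2_f; rewrite ?inE.
Qed.

(** In a saturated supergraph, a nonadjacent pair would have degree sum at least [#|T|], against
    Ore's condition. *)
Lemma dirac G :
  3 <= #|T| -> (forall x, #|T| <= (degree G x).*2) -> hamiltonian G.
Proof.
move=> T_ge3 deg_ge; apply/hamiltonianP/contraT => /hamiltonianP nhamG.
have [G' subG satG] := saturated_supergraph nhamG.
have [u [v [neq_uv Guv]]] := saturated_nonadjacent T_ge3 satG.
have := saturated_degree_sum T_ge3 satG neq_uv Guv.
have := degree_subrel u subG; have := degree_subrel v subG.
by have := deg_ge u; have := deg_ge v; lia.
Qed.

(** * Edge counts and vertices of low degree *)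

Lemma num_edges_leq G D k :
    {in D, forall x, degree G x <= k} ->
  num_edges G <= 'C(#|T| - #|D|, 2) + #|D| * k.
Proof.
move=> deg_le.
pose star x : {set {set T}} := [set [set x; y] | y in [set y | G x y]].
(* An edge either avoids [D] or belongs to the star of one of its ends in [D]; each star has at most
   [k] edges. *)
have /subset_leq_card : edges G \subset
    [set e : {set T} | (e \subset ~: D) && (#|e| == 2)] :|: \bigcup_(x in D) star x.
  apply/subsetP=> _ /imset2P[x y _ Gxy ->]; rewrite inE /= in Gxy.
  apply/setUP; have [xD|xND] := boolP (x \in D).
    by right; apply/bigcupP; exists x => //; apply: imset_f; rewrite inE.
  have [yD|yND] := boolP (y \in D).
    right; apply/bigcupP; exists y => //; rewrite setUC; apply: imset_f.
    by rewrite inE adj_sym.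
  left; rewrite inE subUset !sub1set !inE xND yND cards2.
  by rewrite (contraTneq _ Gxy) // => ->; rewrite adj_irrefl.
move/leq_trans; apply; apply: leq_trans (leq_card_setU _ _) _.
apply: leq_add; first by rewrite cards_draws cardsCs setCK.
apply: leq_trans (_ : \sum_(x in D) #|star x| <= _).
  elim/big_rec2: _ => [|x a b _ le_ab]; first by rewrite cards0.
  by apply: leq_trans (leq_card_setU _ _) _; rewrite leq_add2l.
rewrite -sum_nat_const; apply: leq_sum => x xD.
exact: leq_trans (leq_imset_card _ _) (deg_le x xD).
Qed.

Lemma num_edges_leq_h G k :
  k <= #|[set x | degree G x <= k]| -> num_edges G <= h #|T| k.
Proof.
move=> /card_geqP[s [s_uniq s_size s_sub]].
have card_s : #|[set:: s]| = k by rewrite cardsE -s_size; apply/card_uniqP.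
have := @num_edges_leq G [set:: s] k; rewrite card_s; apply=> x.
by rewrite inE => /s_sub; rewrite inE.
Qed.

Lemma card_non_neighbours G x :
  #|~: (x |: [set y | G x y])| + (degree G x).+1 = #|T|.
Proof. by rewrite addnC -(cardsC (x |: [set y | G x y])) cardsU1 inE adj_irrefl. Qed.

(** Take a nonadjacent pair with maximal degree sum and let [k] be the smaller degree, at [u]. By
    maximality every non-neighbour of [v] has degree at most [k], and by Ore there are at least [k]
    of them. *)
Lemma saturated_low_degree_set G :
    3 <= #|T| -> saturated G -> (forall x, 0 < degree G x) ->
  exists k, [/\ 0 < k, k <= (#|T| - 1) %/ 2 & k <= #|[set x | degree G x <= k]|].
Proof.
move=> T_ge3 satG deg_gt0.
have [u0 [v0 [neq0 G0]]] := saturated_nonadjacent T_ge3 satG.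
pose P (p : T * T) := (p.1 != p.2) && ~~ G p.1 p.2.
have P0 : P (u0, v0) by rewrite /P neq0.
case: (arg_maxnP (fun p : T * T => degree G p.1 + degree G p.2) P0) => -[u v] Puv max_uv.
wlog le_uv : u v Puv max_uv / degree G u <= degree G v.
  move=> IH; have [le_uv|/ltnW le_vu] := leqP (degree G u) (degree G v).
    exact: (IH u v).
  apply: (IH v u) => //; first by rewrite /P /= eq_sym adj_sym.
  by move=> p Pp; rewrite /= [leqRHS]addnC; apply: max_uv.
have {Puv} [neq_uv Guv] : u != v /\ ~~ G u v by case/andP: Puv.
have deg_sum := saturated_degree_sum T_ge3 satG neq_uv Guv.
exists (degree G u); split; [exact: deg_gt0 | by lia |].
apply: leq_trans (_ : #|~: (v |: [set y | G v y])| <= _).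
  by have := card_non_neighbours G v; lia.
apply/subset_leq_card/subsetP=> z; rewrite !inE negb_or => /andP[neq_zv Gvz].
have := max_uv (z, v); rewrite /P /= neq_zv adj_sym Gvz => /(_ isT).
by rewrite leq_add2r.
Qed.

Lemma saturated_clique G :
    3 <= #|T| -> saturated G -> (forall x, 0 < degree G x) ->
    h #|T| ((#|T| - 1) %/ 2) < num_edges G ->
  exists k, [/\ 0 < k <= (#|T| - 1) %/ 2,
    #|[set x | degree G x <= k]| = k &
    forall x y, k < degree G x -> k < degree G y -> x != y -> G x y].
Proof.
move=> T_ge3 satG deg_gt0 edges_gt; set m := (_ %/ 2) in edges_gt *.
pose P k := [&& 0 < k, k <= m & k <= #|[set x | degree G x <= k]|].
have exP : exists k, P k.
  have [k [k_gt0 k_le k_card]] := saturated_low_degree_set T_ge3 satG deg_gt0.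
  by exists k; apply/and3P.
have leP k : P k -> k <= m by case/and3P.
case: (ex_maxnP exP leP) => k /and3P[k_gt0 le_km k_card] k_max.
(* [P m] would bound the number of edges by [h #|T| m]. *)
have NPm : ~~ P m.
  rewrite /P leqnn (leq_trans k_gt0 le_km) /= -ltnNge ltnNge.
  by apply: contraL edges_gt => /num_edges_leq_h; rewrite -leqNgt.
have lt_km : k < m.
  rewrite ltn_neqAle le_km andbT; apply: contraNneq NPm => <-.
  by rewrite /P k_gt0 le_km.
exists k; split=> //; first by rewrite k_gt0.
  apply/eqP; rewrite eqn_leq k_card andbT leqNgt; apply/negP => lt_card.
  (* With more than [k] vertices of degree at most [k], the value [k.+1] would also qualify. *)
  suffices /k_max : P k.+1 by rewrite ltnn.
  rewrite /P lt_km (leq_trans lt_card) //; apply/subset_leq_card/subsetP=> x.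
  by rewrite !inE => /leqW.
(* Among the nonadjacent pairs of vertices of degree above [k], choose one whose first vertex [x]
   has the largest degree. By Ore each of the non-neighbours of [x], forming [D'], has degree at
   most [#|D'|]. *)
pose Q (p : T * T) := [&& k < degree G p.1, k < degree G p.2, p.1 != p.2 & ~~ G p.1 p.2].
move=> x0 y0 x0_gt y0_gt neq0; apply: contraT => G0.
have Q0 : Q (x0, y0) by rewrite /Q /= x0_gt y0_gt neq0.
case: (arg_maxnP (fun p : T * T => degree G p.1) Q0) => -[x y] /and4P[/=].
move=> x_gt y_gt neq_xy Gxy max_x {x0 y0 x0_gt y0_gt neq0 G0 Q0}.
pose D' := ~: (x |: [set z | G x z]).
have card_D' : #|D'| + (degree G x).+1 = #|T| := card_non_neighbours G x.
have D'P z : z \in D' -> z != x /\ ~~ G x z.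
  by rewrite !inE negb_or => /andP[].
have D'_deg z : z \in D' -> degree G z <= #|D'|.
  case/D'P; rewrite eq_sym => neq Gxz.
  by have := saturated_degree_sum T_ge3 satG neq Gxz; lia.
have yD' : y \in D' by rewrite !inE negb_or eq_sym neq_xy.
have k_lt : k < #|D'| by apply: leq_trans y_gt (D'_deg y yD').
(* If [#|D'| <= m], then [#|D'|] contradicts the maximality of [k]. Otherwise [degree G x <= m], and
   by the choice of [x] all of [D'] has degree at most [m], which gives [P m]. *)
have [le_m|gt_m] := leqP #|D'| m.
  suffices /k_max : P #|D'| by lia.
  rewrite /P le_m (leq_trans _ k_lt) //=; apply/subset_leq_card/subsetP=> z.
  by rewrite inE => /D'_deg.
case/negP: NPm; rewrite /P leqnn (leq_trans k_gt0 le_km) /=.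
apply: leq_trans (ltnW gt_m) _; apply/subset_leq_card/subsetP=> z /D'P[neq_zx Gxz].
rewrite inE; have [z_le|z_gt] := leqP (degree G z) k; first exact: leq_trans le_km.
apply: leq_trans (_ : degree G x <= _); last by rewrite /m in gt_m *; lia.
by apply: (max_x (z, x)); rewrite /Q /= z_gt x_gt neq_zx adj_sym.
Qed.

End Saturation.

(** * Hamiltonian cycles in joins, and embeddings into ordinals *)

Section Joins.
Variable T : finType.
Implicit Types (G : sgraph T) (x y : T) (D W S X Y : {set T}).

(** The induced subgraph lives on a subtype, so that Dirac's theorem applies to it. *)
Definition induced_rel G W : rel {x | x \in W} :=
  fun a b : {x | x \in W} => G (val a) (val b).

Lemma induced_sym G W : symmetric (@induced_rel G W).
Proof. by move=> x y; apply: adj_sym. Qed.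

Lemma induced_irrefl G W : irreflexive (@induced_rel G W).
Proof. by move=> x; apply: adj_irrefl. Qed.

Definition induced G W : sgraph {x | x \in W} :=
  SGraph (@induced_sym G W) (@induced_irrefl G W).

Lemma degree_induced G W (a : {x | x \in W}) :
  degree (induced G W) a = #|[set y in W | G (val a) y]|.
Proof.
rewrite /degree -(card_imset _ val_inj); apply: eq_card => y; rewrite inE.
apply/imsetP/andP => [[z]|[yW Gxy]]; first by rewrite inE => Gxz ->; split=> //; apply: valP.
by exists (Sub y yW); rewrite ?inE.
Qed.

(* The set W below spans, by Dirac, a cycle visiting D; it is cut open at a
   vertex of S and closed up through s0 and the clique. *)
Lemma hamiltonian_of_join G D S :
    [disjoint D & S] -> 1 < #|S| < #|D| ->
    {in D, forall x, degree G x = #|D|} ->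
    {in D & S, forall x y, G x y} ->
    {in D, forall x y, G x y -> y \in D :|: S} ->
    (forall x y, x \notin D -> y \notin D -> x != y -> G x y) ->
  hamiltonian G.
Proof.
move=> disDS /andP[S_gt1 S_lt] D_deg DS_join D_nbr cliq.
have /card_gt0P[s0 s0S] : 0 < #|S| by apply: ltnW.
have SND x : x \in S -> x \notin D by apply: contraTN => /(disjointFr disDS)->.
have card_S' : #|S :\ s0|.+1 = #|S| by rewrite (cardsD1 s0 S) s0S.
have /card_gt0P[s1 s1S'] : 0 < #|S :\ s0| by rewrite -ltnS card_S'.
have [neq_s10 s1S] : s1 != s0 /\ s1 \in S by apply/andP; rewrite -in_setD1.
pose W := D :|: (S :\ s0).
have WE x : (x \in W) = (x \in D) || (x \in S :\ s0) by rewrite inE.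
have disDS' : [disjoint D & S :\ s0] by apply: disjointWr disDS; apply: subD1set.
have card_W : #|W|.+1 = #|D| + #|S|.
  by rewrite cardsU disjoint_setI0 // cards0 subn0 -addnS card_S'.
clearbody W.
have card_sW : #|{: {x | x \in W}}| = #|W| by rewrite card_sig; apply: eq_card.
have s0NW : s0 \notin W by rewrite WE in_setD1 eqxx orbF (SND _ s0S).
have s1W : s1 \in W by rewrite WE s1S' orbT.
have [c [c_ge3 /andP[c_cyc c_uniq] c_all]] : hamiltonian (induced G W).
  apply: dirac => [|[x xW]]; rewrite card_sW.
    by move: S_gt1 S_lt card_W; clear; lia.
  rewrite degree_induced /=.
  (* Within [W], a vertex of [D] loses at most the neighbour [s0] and keeps degree at least
     [#|D| - 1], while [#|W| = #|D| + #|S| - 1] and [#|S| < #|D|]. A vertex of [S :\ s0] is adjacent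
     to all the rest of [W]. *)
  have [xD|xND] := boolP (x \in D).
    have : [set y | G x y] \subset s0 |: [set y in W | G x y].
      apply/subsetP=> y; rewrite !inE => Gxy; rewrite Gxy andbT.
      by have := D_nbr x xD y Gxy; rewrite WE in_setD1 in_setU; case: (y == s0).
    move/subset_leq_card; rewrite -/(degree G x) (D_deg x xD) cardsU1.
    by case: (_ \notin _); move: S_lt card_W; clear; lia.
  have : W :\ x \subset [set y in W | G x y].
    apply/subsetP=> y; rewrite in_setD1 inE => /andP[neq_yx yW]; rewrite yW /=.
    have [yD|yND] := boolP (y \in D); last by rewrite cliq // eq_sym.
    rewrite adj_sym DS_join //; move: xW; rewrite WE (negPf xND) /=.
    by rewrite in_setD1 => /andP[].
  move/subset_leq_card; have := cardsD1 x W; rewrite xW.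
  by move: S_gt1 S_lt card_W; clear; lia.
have [i p def_c] := rot_to (c_all (Sub s1 s1W)).
have p_all x : (x \in s1 :: map val p) = (x \in W).
  rewrite -[s1 :: _]/(map val (Sub s1 s1W :: p)) -def_c.
  apply/mapP/idP => [[y _ ->]|xW]; first exact: valP.
  by exists (Sub x xW); rewrite ?mem_rot ?c_all.
have p_uniq : uniq (s1 :: map val p).
  rewrite -[s1 :: _]/(map val (Sub s1 s1W :: p)) map_inj_uniq; last exact: val_inj.
  by rewrite -def_c rot_uniq.
have G_p : path G s1 (map val p).
  have : cycle (induced G W) (Sub s1 s1W :: p) by rewrite -def_c rot_cycle.
  rewrite /= rcons_path => /andP[G_p _].
  by rewrite -[s1]/(val (Sub s1 s1W : {x | x \in W})) path_map.
move: {c c_ge3 c_cyc c_uniq c_all i def_c} (map val p) p_all p_uniq G_p => {}p p_all p_uniq G_p.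
(* The vertices [s0 :: r] outside [W] all avoid [D], so they form a clique and can be traversed in
   any order. *)
pose r := enum (~: (s0 |: W)).
have rP x : (x \in s0 :: r) = (x \notin W).
  rewrite in_cons mem_enum in_setC in_setU1 negb_or.
  by case: eqP => //= ->; rewrite s0NW.
have r_uniq : uniq (s0 :: r) by rewrite /= enum_uniq mem_enum in_setC setU11.
have rND x : x \in s0 :: r -> x \notin D.
  by rewrite rP; apply: contra; rewrite WE => ->.
have G_r : path G s0 r by apply: clique_path => // x y /rND xND /rND yND; apply: cliq.
have all_uniq : uniq ((s1 :: p) ++ s0 :: r).
  rewrite cat_uniq p_uniq r_uniq andbT andTb; apply/hasPn=> x.
  by rewrite rP -p_all.
exists ((s1 :: p) ++ s0 :: r); split.
- rewrite size_cat.
  have : size (s1 :: p) = #|W| by rewrite -(card_uniqP p_uniq); apply: eq_card.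
  by rewrite /= => ->; move: S_gt1 S_lt card_W; clear; lia.
- apply/andP; split=> //; rewrite /= rcons_path cat_path last_cat G_p /= G_r andbT.
  (* Two links join the paths: the end of [p] to [s0], by the join or the clique, and the end of [r]
     back to [s1], by the clique. *)
  apply/andP; split.
    have : last s1 p \in W by rewrite -p_all mem_last.
    rewrite WE => /orP[lastD|]; first exact: DS_join.
    by rewrite in_setD1 => /andP[neq lastS]; apply: cliq => //; apply: SND.
  apply: cliq; [exact/rND/mem_last|exact: SND|].
  by apply: contraTneq (mem_last s0 r) => ->; rewrite rP negbK.
- by move=> x; rewrite mem_cat p_all rP orbN.
Qed.

(** Listing [X], then [Y :\: X], then the rest makes both sets initial segments, the form in which
    the extremal graphs are defined. *)
Lemma index_embedding X Y :
    X \subset Y ->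
  exists2 f : T -> 'I_#|T|, injective f &
    forall x, ((f x < #|X|) = (x \in X)) * ((f x < #|Y|) = (x \in Y)).
Proof.
move=> sXY; pose s := enum X ++ enum (Y :\: X) ++ enum (~: Y).
have s_all x : x \in s.
  rewrite !mem_cat !mem_enum !inE; case: (x \in X) => //=.
  by case: (x \in Y).
have s_size : size s = #|T|.
  rewrite !size_cat -!cardE addnA -(cardsC Y); congr (_ + _).
  by rewrite -(cardsID X Y) (setIidPr sXY).
have lt_index x : index x s < #|T| by rewrite -s_size index_mem.
exists (fun x => Ordinal (lt_index x)) => [x y [eq_i]|x /=].
  by rewrite -(nth_index x (s_all x)) eq_i nth_index.
have lt_cat (s1 s2 : seq T) : (index x (s1 ++ s2) < size s1) = (x \in s1).
  by rewrite index_cat; case: ifP => xs1; rewrite ?index_mem // ltnNge leq_addr.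
split; first by rewrite cardE lt_cat mem_enum.
have -> : #|Y| = size (enum X ++ enum (Y :\: X)).
  by rewrite size_cat -!cardE -(cardsID X Y) (setIidPr sXY).
rewrite /s catA lt_cat mem_cat !mem_enum !inE.
by have := subsetP sXY x; case: (x \in X) => //= ->.
Qed.

End Joins.

(** * Structure of the saturated graph and the final embedding *)

Lemma leq_min_degree (T : finType) (G : sgraph T) x : min_degree G <= degree G x.
Proof.
rewrite /min_degree; have := mem_index_enum x.
elim: (index_enum T) => // y s IHs; rewrite inE big_cons geq_min.
by case/orP=> [/eqP->|/IHs->]; rewrite ?leqnn ?orbT.
Qed.

Lemma h_convex n a k b : a <= k -> k <= b -> b <= n -> h n k <= maxn (h n a) (h n b).
Proof.
have bin2D m : 'C(m, 2) + 'C(m, 2) + m = m * m.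
  by rewrite addnn bin2 halfK; case: m => //= m; rewrite oddM /= andNb subn0; lia.
move=> /subnKC <- /subnKC <- /subnKC <-; rewrite leq_max /h.
move: (k - a) (b - _) (n - _) => i j p {k b n}.
have -> : a + i + j + p - a = i + (j + p) by lia.
have -> : a + i + j + p - (a + i) = j + p by lia.
have -> : a + i + j + p - (a + i + j) = p by lia.
have := bin2D p; have := bin2D (j + p); have := bin2D (i + (j + p)); rewrite -!mulnn.
move: 'C(p, 2) 'C(j + p, 2) 'C(i + (j + p), 2) => A B C EC EB EA.
(* With [k = a + i], [b = k + j] and [n = b + p], twice [h n a - h n k] equals i(2j + 2p - 4a - i -
   1), and twice [h n b - h n k] equals j(4a + 4i + j + 1 - 2p). *)
have [le|gt] := leqP (4 * a + i + 1) (2 * j + 2 * p); apply/orP.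
  by left; have := leq_mul (leqnn i) le; lia.
have le : 2 * p <= 4 * a + 4 * i + j + 1 by lia.
by right; have := leq_mul (leqnn j) le; lia.
Qed.

Lemma saturated_join (T : finType) (G : sgraph T) d :
    3 <= #|T| -> saturated G -> 0 < d ->
    (forall x, d <= degree G x) ->
    maxn (h #|T| d.+1) (h #|T| ((#|T| - 1) %/ 2)) < num_edges G ->
  exists S D : {set T}, [/\ [disjoint D & S], #|D| = d,
    forall x y, G x y -> x \in D -> y \in D :|: S &
    #|S| = 1 \/ #|S| = d /\ forall x y, G x y -> x \in D -> y \in S].
Proof.
move=> T_ge3 satG d_gt0 deg_ge; rewrite gtn_max => /andP[edges_gt1 edges_gt2].
have [|k [/andP[k_gt0 k_le] card_D cliq]] := saturated_clique T_ge3 satG _ edges_gt2.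
  by move=> x; apply: leq_trans (deg_ge x).
set D := [set x | _] in card_D; have DE x : (x \in D) = (degree G x <= k) by rewrite inE.
have /card_gt0P[x0 x0D] : 0 < #|D| by rewrite card_D.
(* A vertex of [D] gives [d <= k]. If [d < k], convexity between [d.+1] and (n - 1) / 2 bounds
   [h #|T| k], hence the edge count, below the assumed number of edges. *)
have kd : k = d.
  apply/eqP; rewrite eqn_leq andbC (leq_trans (deg_ge x0)) -?DE //= leqNgt.
  apply/negP => lt_dk; have := @num_edges_leq_h T G k; rewrite -/D card_D => /(_ (leqnn k)).
  apply/negP; rewrite -ltnNge; apply: leq_ltn_trans (h_convex lt_dk k_le _) _; first by lia.
  by rewrite gtn_max edges_gt1.
rewrite {}kd in DE card_D cliq k_le {k_gt0}.
clearbody D.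
have D_deg : {in D, forall x, degree G x = #|D|}.
  by move=> x xD; apply/eqP; rewrite card_D eqn_leq deg_ge andbT -DE.
have {}cliq x y : x \notin D -> y \notin D -> x != y -> G x y.
  by rewrite !DE -!ltnNge; apply: cliq.
pose S := [set y in ~: D | [exists x in D, G x y]].
have SE y : (y \in S) = (y \notin D) && [exists x in D, G x y] by rewrite !inE.
have disDS : [disjoint D & S].
  by apply/pred0P => x /=; rewrite SE; case: (x \in D).
have D_nbr x y : G x y -> x \in D -> y \in D :|: S.
  move=> Gxy xD; rewrite in_setU SE orb_andr orbN /=.
  by apply/orP; right; apply/existsP; exists x; rewrite xD.
have S_deg y : y \in S -> #|T| - d <= degree G y.
  rewrite SE => /andP[yND /existsP[x /andP[xD Gxy]]].
  (* The vertex [y] sees the other [#|T| - d - 1] vertices outside [D] and at least one vertex in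
     [D]. *)
  have sub : x |: ~: D :\ y \subset [set z | G y z].
    apply/subsetP=> z; rewrite in_setU1 in_setD1 in_setC in_set.
    case/predU1P=> [->|/andP[neq_zy zND]]; first by rewrite adj_sym.
    by apply: cliq => //; rewrite eq_sym.
  apply: leq_trans (subset_leq_card sub); rewrite cardsU1 in_setD1 in_setC xD andbF add1n.
  have := cardsD1 y (~: D); rewrite in_setC yND; have := cardsC D; rewrite card_D; lia.
have DS_join : {in D & S, forall x y, G x y}.
  move=> x y xD yS; apply: contraT => Gxy.
  have neq_xy : x != y by apply: contraTneq yS => <-; rewrite (disjointFr disDS xD).
  have := saturated_degree_sum T_ge3 satG neq_xy Gxy.
  by have := S_deg y yS; have := D_deg x xD; lia.
have S_sub x : x \in D -> S \subset [set y | G x y].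
  by move=> xD; apply/subsetP=> y yS; rewrite inE DS_join.
have S_le : #|S| <= d.
  by rewrite -card_D -(D_deg x0 x0D); apply: subset_leq_card (S_sub x0 x0D).
(* If [S] were empty, [x0] would have its [d] neighbours among only [d - 1] other vertices of
   [D]. *)
have S_gt0 : 0 < #|S|.
  rewrite lt0n cards_eq0; apply/negP => /eqP S0.
  have : [set y | G x0 y] \subset D :\ x0.
    apply/subsetP=> y; rewrite inE in_setD1 => Gxy.
    have := D_nbr x0 y Gxy x0D; rewrite S0 setU0 => ->; rewrite andbT.
    by apply: contraTneq Gxy => ->; rewrite adj_irrefl.
  move/subset_leq_card; rewrite -/(degree G x0) (D_deg x0 x0D).
  by have := cardsD1 x0 D; rewrite x0D; lia.
exists S, D; split=> //.
have [S_gt1|] := ltnP 1 #|S|; last by left; apply/eqP; rewrite eqn_leq S_gt0 andbT.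
right; have [S_lt|S_ge] := ltnP #|S| d.
  case: satG => nhamG _; case: nhamG.
  apply: (hamiltonian_of_join disDS) => //; first by rewrite S_gt1 card_D.
  by move=> x xD y /D_nbr; apply.
(* Each vertex of [D] has degree [d] and sees all of [S], so [S] is its whole neighbourhood. *)
have cardS : #|S| = d by apply/eqP; rewrite eqn_leq S_le.
split=> // x y Gxy xD.
have /eqP -> : S == [set y | G x y].
  by rewrite eqEcard S_sub //= -/(degree G x) D_deg // card_D.
by rewrite inE.
Qed.

Theorem theorem3 (n d : nat) (T : finType) (G : sgraph T)
    (hn : 3 <= n) (hd1 : 1 <= d) (hd2 : d <= (n - 1) %/ 2)
    (hT : #|T| = n)
    (hG : ~ hamiltonian G)
    (hdelta : d <= min_degree G)
    (he : maxn (h n d.+1) (h n ((n - 1) %/ 2)) < num_edges G) :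
  subgraph_upto_iso G (Hnd n d) \/ subgraph_upto_iso G (Hnd' n d).
Proof.
move: hn hd2 he; rewrite -{}hT => T_ge3 _ edges_gt.
have [G' subG satG'] := saturated_supergraph hG.
have deg_ge x : d <= degree G' x.
  by apply: leq_trans (degree_subrel x subG); apply: leq_trans (leq_min_degree G x).
have [S [D [disDS card_D D_nbr S_cases]]] := saturated_join T_ge3 satG' hd1 deg_ge
  (leq_trans edges_gt (num_edges_subrel subG)).
have card_ND : #|~: D| = #|T| - d by rewrite cardsCs setCK card_D.
have neq_f x y (f : T -> 'I_#|T|) : injective f -> G x y -> f x != f y.
  by move=> f_inj Gxy; rewrite (inj_eq f_inj); apply: contraTneq Gxy => ->; rewrite adj_irrefl.
have SND : S \subset ~: D by rewrite -disjoints_subset disjoint_sym.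
case: S_cases => [card_S|[card_S D_nbrS]]; [right|left].
  (* The single vertex of [S] lands at position [#|T| - d.+1], the vertex shared by the two cliques,
     and [D] fills the last [d] positions. *)
  have sub : ~: (D :|: S) \subset ~: D by rewrite setCS subsetUl.
  have [f f_inj fE] := index_embedding sub.
  exists f => // x y Gxy; rewrite /= /Hnd'_adj (neq_f x y f f_inj Gxy) /=.
  have card_NDS : #|~: (D :|: S)| = #|T| - d.+1.
    by rewrite cardsCs setCK cardsU disjoint_setI0 // cards0 card_D card_S subn0 addn1.
  have f_ND z : (f z < #|T| - d) = (z \notin D) by rewrite -card_ND (fE z).2 in_setC.
  have f_DS z : (#|T| - d.+1 <= f z) = (z \in D :|: S).
    by rewrite leqNgt -card_NDS (fE z).1 in_setC negbK.
  rewrite !f_ND !f_DS.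
  have D_in (a b : T) : G a b -> a \in D -> (a \in D :|: S) && (b \in D :|: S).
    by move=> Gab aD; rewrite in_setU aD; apply: D_nbr (subG _ _ Gab) aD.
  have [xD|xND] := boolP (x \in D); first by rewrite (D_in x y Gxy xD) orbT.
  have [yD|yND] := boolP (y \in D); last by [].
  have /andP[-> ->] : (y \in D :|: S) && (x \in D :|: S) by rewrite D_in // adj_sym.
  by rewrite orbT.
(* Here [S] takes the first [d] positions and [D] the last [d]. *)
have [f f_inj fE] := index_embedding SND.
exists f => // x y Gxy; rewrite /= /Hnd_adj (neq_f x y f f_inj Gxy) /=.
have f_S z : (f z < d) = (z \in S) by rewrite -card_S (fE z).1.
have f_ND z : (f z < #|T| - d) = (z \notin D) by rewrite -card_ND (fE z).2 in_setC.
have f_D z : (#|T| - d <= f z) = (z \in D) by rewrite leqNgt f_ND negbK.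
rewrite !f_ND !f_D !f_S.
have D_in (a b : T) : G a b -> a \in D -> b \in S by move=> /subG; apply: D_nbrS.
have [xD|xND] := boolP (x \in D); first by rewrite (D_in x y Gxy xD) !orbT.
have [yD|yND] := boolP (y \in D); last by [].
by rewrite (D_in y x) ?orbT // adj_sym.
Qed.
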